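(* Let $\mathcal{C}$ be a hypergraph. (i) If $\psi(\mathcal{C})\ge 2$, then $\operatorname{Ind}(\mathcal{C})$ is path-connected. (ii) If $\psi(\mathcal{C})\ge 3$, then $\operatorname{Ind}(\mathcal{C})$ is simply-connected.
   Context: A hypergraph $\mathcal{C}$ on a finite vertex set $V$ is a family of pairwise incomparable subsets of $V$ (its edges), each of cardinality at least $2$; vertices lying in no edge are allowed. The independence complex $\operatorname{Ind}(\mathcal{C})$ is the simplicial complex on $V$ whose faces are the subsets of $V$ containing no edge of $\mathcal{C}$. For an edge $F$: $\mathcal{C}-F$ is the hypergraph on $V$ with edge set $\mathcal{C}\setminus\{F\}$; $N_{\mathcal{C}}(F)=\bigcup\{E\setminus F : E\in\mathcal{C},\ |E\setminus F|=1\}$; and $\mathcal{C}:F$ is the hypergraph on $V\setminus(F\cup N_{\mathcal{C}}(F))$ whose edges are the members of cardinality at least $2$ among the inclusion-minimal members of the family $\{E\setminus F : E\in \mathcal{C}-F\}$. The number $\psi(\mathcal{C})\in\mathbb{Z}_{\ge 0}\cup\{\infty\}$ is defined recursively: $\psi(\mathcal{C})=0$ if $V=\emptyset$; $\psi(\mathcal{C})=\infty$ if $V\neq\emptyset$ and $\mathcal{C}$ has no edges; otherwise $\psi(\mathcal{C})=\max_{F\in\mathcal{C}}\min\{\psi(\mathcal{C}-F),\ \psi(\mathcal{C}:F)+|F|-1\}$. *)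

(* Defs.v *)
From HB Require Import structures.
From mathcomp Require Import all_boot all_order all_algebra.
From mathcomp Require Import all_classical all_reals all_analysis.
Set Implicit Arguments. Unset Strict Implicit. Unset Printing Implicit Defensive.
Import Order.TTheory GRing.Theory Num.Theory.
Import numFieldNormedType.Exports.

Inductive ninf := NFin of nat | NInf.

Definition ninf_le (a b : ninf) : bool :=
  match a, b with
  | _, NInf => true
  | NInf, NFin _ => false
  | NFin m, NFin n => (m <= n)%N
  end.
Definition ninf_min (a b : ninf) : ninf := if ninf_le a b then a else b.
Definition ninf_max (a b : ninf) : ninf := if ninf_le a b then b else a.
Definition ninf_addn (a : ninf) (k : nat) : ninf :=
  match a with NFin m => NFin (m + k) | NInf => NInf end.

Definition is_hypergraph {T : finType} (V : {set T}) (C : {set {set T}}) : Prop :=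
  (forall E, E \in C -> E \subset V) /\
  (forall E, E \in C -> (2 <= #|E|)%N) /\
  (forall E E', E \in C -> E' \in C -> E \subset E' -> E = E').

Definition is_face {T : finType} (V : {set T}) (C : {set {set T}}) (S : {set T}) : bool :=
  (S \subset V) && [forall E in C, ~~ (E \subset S)].

Definition hnbhd {T : finType} (C : {set {set T}}) (F : {set T}) : {set T} :=
  \bigcup_(E in C | #|E :\: F| == 1%N) (E :\: F).

Definition hlinkV {T : finType} (V : {set T}) (C : {set {set T}}) (F : {set T}) : {set T} :=
  V :\: (F :|: hnbhd C F).
Definition hlinkC {T : finType} (C : {set {set T}}) (F : {set T}) : {set {set T}} :=
  let D := [set E :\: F | E in C :\ F] in
  [set G in D | [forall H in D, (H \subset G) ==> (H == G)] && (2 <= #|G|)%N].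

(* psi, by recursion with fuel; the fuel #|V| + #|C| + 1 is always sufficient,
   since #|V| + #|C| strictly decreases along both recursive calls. *)
Fixpoint psi_fuel {T : finType} (n : nat) (V : {set T}) (C : {set {set T}}) : ninf :=
  match n with
  | 0 => NInf
  | n'.+1 =>
    if V == finset.set0 then NFin 0
    else if C == finset.set0 then NInf
    else \big[ninf_max/NFin 0]_(F in C)
           ninf_min (psi_fuel n' V (C :\ F))
                    (ninf_addn (psi_fuel n' (hlinkV V C F) (hlinkC C F)) (#|F| - 1))
  end.

Definition psi {T : finType} (V : {set T}) (C : {set {set T}}) : ninf :=
  psi_fuel (#|V| + #|C|).+1 V C.

Local Open Scope ring_scope.
Local Open Scope classical_set_scope.

(* points are barycentric coordinate functions x : T -> R, supported in V,
   nonnegative, summing to 1, whose support is a face; topology = subspace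
   topology of R^T (product topology). *)
Definition realization {R : realType} {T : finType} (V : {set T}) (C : {set {set T}})
  : set (T -> R) :=
  [set x | (forall v, 0 <= x v) /\ (forall v, v \notin V -> x v = 0) /\
           (\sum_(v : T) x v = 1) /\ is_face V C [set v | x v != 0]].

Definition unit_interval {R : realType} : set R := `[0, 1]%classic.

(* a path in X from a to b: continuous map [0,1] -> X (continuity into R^T
   being coordinatewise continuity, i.e. the product topology) *)
Definition is_path {R : realType} {T : finType} (X : set (T -> R))
  (g : R -> T -> R) (a b : T -> R) : Prop :=
  (forall v, {within unit_interval (R := R), continuous (fun t : R => g t v)}) /\
  (forall t, unit_interval t -> X (g t)) /\ g 0 = a /\ g 1 = b.

Definition path_connected {R : realType} {T : finType} (X : set (T -> R)) : Prop :=
  (exists x, X x) /\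
  (forall a b, X a -> X b -> exists g, is_path X g a b).

Definition unit_square {R : realType} : set (R * R) :=
  [set p | unit_interval p.1 /\ unit_interval p.2].

Definition simply_connected {R : realType} {T : finType} (X : set (T -> R)) : Prop :=
  path_connected X /\
  forall g : R -> T -> R, is_path X g (g 0) (g 0) ->
    exists H : R * R -> T -> R,
      (forall v, {within unit_square (R := R), continuous (fun p : R * R => H p v)}) /\
      (forall p, unit_square p -> X (H p)) /\
      (forall t, unit_interval t -> H (t, 0) = g t /\ H (t, 1) = g 0) /\
      (forall s, unit_interval s -> H (0, s) = g 0 /\ H (1, s) = g 0).

(* Main.v *)
(** By induction on the recursion defining [psi]. For an edge [F] attaining the
maximum, [K' = Ind (C - F)] is [K = Ind C] with the faces [F :|: S] added, for [S]
in [L = Ind (C : F)], so [K] is recovered from [K'] by rerouting edge paths. An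
edge [F = {a, b}] is replaced by [a, z, b] for a vertex [z] of [L]; if [L] is
connected, the choice of [z] does not matter up to homotopy, and so triangles
containing [F] are sent to null-homotopic loops. If [#|F| = 3], then only the
triangle [F] is lost, and a cone over its boundary with apex in [L] replaces it.
If [#|F| > 3], nothing changes up to dimension 2.

On the topological side, every loop is freely homotopic to a piecewise linear one
by uniform continuity, every move on edge paths is a free homotopy of the
corresponding piecewise linear loops, and a loop that is freely homotopic to a
constant one is null-homotopic. *)

Require Import Defs.
From HB Require Import structures.
From mathcomp Require Import all_boot all_order all_algebra.
From mathcomp Require Import all_classical all_reals all_analysis.
From mathcomp Require Import lra zify.

Set Implicit Arguments.
Unset Strict Implicit.
Unset Printing Implicit Defensive.

(** * Edge-path homotopy *)

Section Walks.
Variable T : finType.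
Implicit Types (K L : pred {set T}) (F S : {set T}) (w u v : seq T).

Definition down_closed K := forall S S', S' \subset S -> K S -> K S'.

(** For [x = y] this says that [x] is a vertex, so walks are allowed to pause. *)
Definition adj K x y := K [set x; y].

(* With [b = a] or [b = c] the move deletes a repetition, and with [c = a] a
   backtracking. *)
Inductive walk_homotopic K : seq T -> seq T -> Prop :=
| hom_del u v a b c :
    K [set a; b; c] -> walk_homotopic K (u ++ [:: a, b, c & v]) (u ++ [:: a, c & v])
| hom_refl w : walk_homotopic K w w
| hom_sym w w' : walk_homotopic K w w' -> walk_homotopic K w' w
| hom_trans w1 w2 w3 : walk_homotopic K w1 w2 -> walk_homotopic K w2 w3 -> walk_homotopic K w1 w3.

Definition walk_connected K :=
  forall x y, K [set x] -> K [set y] -> connect (adj K) x y.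

(** The trivial loop is [[:: x; x]] because a move keeps the first and the last entry, so that two
    entries always remain. *)
Definition walk_simply_connected K :=
  forall x p, path (adj K) x (rcons p x) -> walk_homotopic K (x :: rcons p x) [:: x; x].

Lemma hom_ctx K u v w w' : walk_homotopic K w w' -> walk_homotopic K (u ++ w ++ v) (u ++ w' ++ v).
Proof.
elim=> [u' v' a b c Kabc|w1|w1 w2 _|w1 w2 w3 _ h12 _ h23].
- by rewrite -!catA /= !(catA u u'); apply: hom_del.
- exact: hom_refl.
- exact: hom_sym.
- exact: hom_trans h23.
Qed.

Lemma hom_del3 K a b c : K [set a; b; c] -> walk_homotopic K [:: a; b; c] [:: a; c].
Proof. exact: (@hom_del K [::] [::]). Qed.

Lemma hom_dup K a b : K [set a; b] -> walk_homotopic K [:: a; a; b] [:: a; b].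
Proof. by move=> Kab; apply: hom_del3; rewrite finset.setUid. Qed.

Lemma hom_dupr K a b : K [set a; b] -> walk_homotopic K [:: a; b; b] [:: a; b].
Proof. by move=> Kab; apply: hom_del3; rewrite -finset.setUA finset.setUid. Qed.

Lemma hom_back K a b : K [set a; b] -> walk_homotopic K [:: a; b; a] [:: a; a].
Proof.
by move=> Kab; apply: hom_del3; rewrite finset.setUC finset.setUA finset.setUid.
Qed.

(** Extends a rule [m] for rerouting single edges to whole walks; all vertices of the walk are
    kept. *)
Fixpoint fill (m : T -> T -> seq T) w : seq T :=
  if w is x :: w' then
    if w' is y :: _ then x :: m x y ++ fill m w' else [:: x]
  else [::].

(** The prefix [p] is chosen before [v], so the two sides of a move share it. *)
Lemma fill_cat m u a : exists p, forall v, fill m (u ++ a :: v) = p ++ fill m (a :: v).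
Proof.
elim: u => [|x u [p IH]]; first by exists [::].
case: u IH => [|y u] IH.
  by exists (x :: m x a).
by exists (x :: m x y ++ p) => v; have := IH v; rewrite /= => ->; rewrite catA.
Qed.

Lemma fill_head m a v : exists q, fill m (a :: v) = a :: q.
Proof. by case: v => [|b v]; eexists. Qed.

(** A rerouting of edges respects homotopy as soon as it does so on each triangle; degenerate
    triangles are included in the hypothesis and account for repetitions and backtracking. *)
Lemma hom_fill K K' m :
  (forall a b c, K' [set a; b; c] ->
     walk_homotopic K (a :: m a b ++ b :: m b c ++ [:: c]) (a :: m a c ++ [:: c])) ->
  forall w w', walk_homotopic K' w w' -> walk_homotopic K (fill m w) (fill m w').
Proof.
move=> tri w w'; elim=> {w w'} [u v a b c K'abc|w|w1 w2 _|w1 w2 w3 _ h12 _ h23].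
- have [p Ep] := fill_cat m u a; rewrite !Ep.
  have [q Eq] := fill_head m c v.
  have := hom_ctx p q (tri _ _ _ K'abc).
  have -> : fill m [:: a, b, c & v] = a :: m a b ++ b :: m b c ++ fill m (c :: v) by [].
  have -> : fill m [:: a, c & v] = a :: m a c ++ fill m (c :: v) by [].
  by rewrite Eq /= -!catA /= -!catA.
- exact: hom_refl.
- exact: hom_sym.
- exact: hom_trans h23.
Qed.

Lemma fill_id K m x p :
  (forall x y, K [set x; y] -> m x y = [::]) -> path (adj K) x p ->
  fill m (x :: p) = x :: p.
Proof.
move=> mE; elim: p x => [//|y p IH] x /= /andP[Kxy pth].
by rewrite (mE _ _ Kxy) /= -[RHS]/(x :: (y :: p)) -(IH y pth).
Qed.

(** Rerouting acts as a retraction on walks: a closed walk of [K] is contracted in [K'], and the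
    contraction is pushed back into [K] by [fill m], which fixes the walk itself. *)
Lemma walk_simply_connected_fill K K' m :
  down_closed K ->
  (forall S, K S -> K' S) ->
  (forall x y, K [set x; y] -> m x y = [::]) ->
  (forall a b c, K' [set a; b; c] ->
     walk_homotopic K (a :: m a b ++ b :: m b c ++ [:: c]) (a :: m a c ++ [:: c])) ->
  walk_simply_connected K' -> walk_simply_connected K.
Proof.
move=> dcK KK' mE tri scK' x p pth.
have pth' : path (adj K') x (rcons p x) by apply: sub_path pth => ? ?; apply: KK'.
have := hom_fill tri (scK' x p pth').
rewrite (fill_id mE pth) (@fill_id K) //= andbT.
(* The constant walk [[:: x; x]] must be fixed too; that [x] is a vertex is read off the first edge
   of the closed walk. *)
apply: dcK (_ : K [set x; head x (rcons p x)]); first by rewrite finset.setUid finset.subsetUl.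
by case: p {pth'} pth => [|y q] /= /andP[].
Qed.

(* [K = Ind C], [K' = Ind (C - F)] and [L = Ind (C : F)]. *)
Section EdgeRemoval.
Variables (K K' L : pred {set T}) (F : {set T}).
Hypotheses (dcK : down_closed K) (dcK' : down_closed K').
Hypothesis (KP : forall S, K S = K' S && ~~ (F \subset S)).
Hypothesis (LF : forall S, L S -> [disjoint S & F]).
Hypothesis (LK' : forall S, L S -> K' (F :|: S)).
Hypothesis (K'L : forall z, z \notin F -> K' (F :|: [set z]) -> L [set z]).

Lemma link_notin z : L [set z] -> z \notin F.
Proof. by move/LF; rewrite finset.disjoints1. Qed.

(** Source of all the simplices of [K] used for rerouting: inside [F :|: S] only the sets containing
    all of [F] fail to be faces of [K]. *)
Lemma join_face S S' f : L S -> f \in F -> f \notin S' -> S' \subset F :|: S -> K S'.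
Proof.
move=> LS fF fS' sS'; rewrite KP (dcK' sS' (LK' LS)) /=.
by apply: contra fS' => /fintype.subsetP; apply.
Qed.

Ltac fset_sub :=
  apply/fintype.subsetP => ?; rewrite !inE;
  do ?[case/orP]; move/eqP->; by rewrite ?eqxx ?orbT.

(** Passes through [[:: a; z; z'; b]], across the two triangles that share the edge from [z] to
    [z']. *)
Lemma hom_link_edge a b z z' :
  F = [set a; b] -> a != b -> L [set z; z'] -> walk_homotopic K [:: a; z; b] [:: a; z'; b].
Proof.
move=> FE ab Lzz.
have nz (c : T) : c \in F -> c \notin [set z; z'].
  by move=> cF; apply/negP => cz; have := disjointFr (LF Lzz) cz; rewrite cF.
have aF : a \in F by rewrite FE !inE eqxx.
have bF : b \in F by rewrite FE !inE eqxx orbT.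
have Ka : K [set a; z; z'].
  apply: (join_face Lzz bF); last by rewrite FE; fset_sub.
  by have := nz b bF; rewrite !inE !negb_or [b == a]eq_sym ab.
have Kb : K [set z; z'; b].
  apply: (join_face Lzz aF); last by rewrite FE; fset_sub.
  by have := nz a aF; rewrite !inE !negb_or ab andbT.
refine (hom_trans (hom_sym (hom_ctx [:: a] [::] (hom_del3 Kb))) _) => /=.
exact (hom_ctx [::] [:: b] (hom_del3 Ka)).
Qed.

(** The detour vertex is moved along a walk in the link, one edge at a time. *)
Lemma hom_link a b z z' :
  F = [set a; b] -> a != b -> walk_connected L -> L [set z] -> L [set z'] ->
  walk_homotopic K [:: a; z; b] [:: a; z'; b].
Proof.
move=> FE ab cL Lz Lz'; have /connectP[p + ->] := cL _ _ Lz Lz'.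
elim: p z {Lz Lz'} => [|y p IH] z /=; first by move=> _; apply: hom_refl.
case/andP=> Lzy /IH; apply: hom_trans; exact: hom_link_edge.
Qed.

(** The set [[set f; z]] misses a second vertex [g] of [F], so [join_face] applies. *)
Lemma link_edge_face z f : L [set z] -> f \in F -> (2 <= #|F|)%N -> K [set f; z].
Proof.
move=> Lz fF cF; have [g gF gf] : exists2 g, g \in F & g != f.
  apply/exists_inP; rewrite -[_ _ _]negbK negb_exists_in.
  apply/negP => /forall_inP FE; have : (#|F| <= #|[set f]|)%N.
    apply/subset_leq_card/fintype.subsetP => x /FE; by rewrite negbK inE.
  by rewrite finset.cards1 leqNgt cF.
have zF := link_notin Lz.
apply: (join_face Lz gF).
  by rewrite !inE (negPf gf); apply: contra zF => /eqP <-.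
by apply/fintype.subsetP => x; rewrite !inE => /orP[] /eqP->; rewrite ?fF ?eqxx ?orbT.
Qed.

Lemma walk_simply_connected_link :
  (2 <= #|F|)%N ->
  (#|F| = 2 -> (exists z, L [set z]) /\ walk_connected L) ->
  (#|F| = 3 -> exists z, L [set z]) ->
  walk_simply_connected K' -> walk_simply_connected K.
Proof.
move=> cF c2 c3; have KK' S : K S -> K' S by rewrite KP => /andP[].
have Kn S : K' S -> ~~ (F \subset S) -> K S by rewrite KP => -> ->.
(* If [F] has more than two vertices, no edge is lost and no detour is inserted; a triangle is lost
   only if it equals [F]. *)
have [F2|F2] := eqVneq #|F| 2; last first.
  apply: (@walk_simply_connected_fill _ _ (fun _ _ => [::])) => // a b c K'abc /=.
  have [FS|/(Kn _ K'abc)] := boolP (F \subset [set a; b; c]); last exact: hom_del3.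
  have c3' : (#|[set a; b; c]| <= 3)%N.
    by rewrite -finset.setUA finset.cardsU1 finset.cards2; lia.
  have F3 : #|F| = 3 by have := subset_leq_card FS; lia.
  have FE : F = [set a; b; c].
    by apply/eqP; rewrite eqEcard FS F3.
  have [w Lw] := c3 F3.
  have wF := link_notin Lw.
  have [ab ac bc] : [/\ a != b, a != c & b != c].
    move: F3; rewrite FE -finset.setUA finset.cardsU1 finset.cards2 !inE negb_or.
    by do 3 case: eqP.
  have Kabw : K [set a; w; b].
    apply: (join_face Lw (_ : c \in F)); [by rewrite FE !inE eqxx ?orbT| |by rewrite FE; fset_sub].
    move: wF; rewrite FE !inE !negb_or ![c == _]eq_sym ac bc andbT /=.
    by case/andP.
  have Kwbc : K [set w; b; c].
    apply: (join_face Lw (_ : a \in F)); [by rewrite FE !inE eqxx ?orbT| |by rewrite FE; fset_sub].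
    move: wF; rewrite FE !inE !negb_or [a == w]eq_sym ab ac !andbT /=.
    by case/andP => /andP[].
  have Kawc : K [set a; w; c].
    apply: (join_face Lw (_ : b \in F)); [by rewrite FE !inE eqxx ?orbT| |by rewrite FE; fset_sub].
    move: wF; rewrite FE !inE !negb_or [b == w]eq_sym [b == a]eq_sym ab bc !andbT /=.
    by case/andP => /andP[].
  (* Across the three triangles of the cone with apex [w]: from [[:: a; b; c]] to [[:: a; w; b; c]],
     [[:: a; w; c]] and [[:: a; c]]. *)
  refine (hom_trans (hom_sym (hom_ctx [::] [:: c] (hom_del3 Kabw))) _) => /=.
  refine (hom_trans (hom_ctx [:: a] [::] (hom_del3 Kwbc)) _) => /=.
  exact: hom_del3.
have [[w Lw] cL] := c2 F2.
have wF := link_notin Lw.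
(* The lost edge is detoured through the same [w] in both directions. The cases below ask which side
   of the triangle, if any, equals [F]. *)
pose m x y := if [set x; y] == F then [:: w] else [::].
apply: (@walk_simply_connected_fill _ _ m) => // [x y|a b c K'abc].
  by rewrite /m KP; case: eqP => // ->; rewrite fintype.subxx andbF.
have mE x y : ~~ (F \subset [set x; y]) -> m x y = [::].
  by rewrite /m; case: eqP => // ->; rewrite fintype.subxx.
have mxx x : m x x = [::].
  apply: mE; apply/negP => /subset_leq_card; rewrite finset.setUid finset.cards1; lia.
have neqF x y : [set x; y] = F -> x != y.
  by move=> xyF; apply/eqP => xy; move: F2; rewrite -xyF xy finset.setUid finset.cards1.
have mC x y : m x y = m y x by rewrite /m finset.setUC.
have m1 x y : [set x; y] = F -> m x y = [:: w] by rewrite /m => ->; rewrite eqxx.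
have LK z f : z \notin F -> K' (F :|: [set z]) -> f \in F -> K [set f; z].
  by move=> zF Fz fF; apply: (link_edge_face (K'L zF Fz)) => //; rewrite F2.
have wK f : f \in F -> K [set f; w] by move=> fF; apply: (link_edge_face Lw) => //; rewrite F2.
have out x z : z \notin F -> m x z = [::].
  by rewrite /m; case: eqP => // <-; rewrite !inE eqxx orbT.
have [abF|abF] := eqVneq [set a; b] F.
  have aF : a \in F by rewrite -abF !inE eqxx.
  have bF : b \in F by rewrite -abF !inE eqxx orbT.
  rewrite (m1 _ _ abF).
  (* If [c] is outside [F], then the triangle is [F :|: [set c]], so [c] lies in the link. Moving
     the detour from [w] to [c] gives [[:: a; c; b; c]], and the backtracking at its end is
     deleted. *)
  have [inF|inF] := boolP (c \in F); last first.
    have Fc : K' (F :|: [set c]) by rewrite -abF.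
    rewrite !out //=.
    refine (hom_trans (hom_ctx [::] [:: c] (hom_link (esym abF) (neqF _ _ abF) cL Lw (K'L inF Fc))) _) => /=.
    have Kcb : K [set c; b] by rewrite finset.setUC LK.
    have Kac : K [set a; c] by rewrite LK.
    refine (hom_trans (hom_ctx [:: a] [::] (hom_back Kcb)) _) => /=.
    exact: hom_dupr.
  (* Degenerate triangles: for [c = a] the detour is run forth and back, for [c = b] it is followed
     by a repetition. *)
  move: inF; rewrite -abF !inE => /orP[] /eqP->.
    rewrite mC (m1 _ _ abF) mxx /=.
    refine (hom_trans (hom_ctx [:: a] [:: a] (hom_back _)) _) => /=; first by rewrite finset.setUC wK.
    refine (hom_trans (hom_ctx [:: a] [::] (hom_dup _)) _) => /=; first by rewrite finset.setUC wK.
    by apply: hom_back; rewrite wK.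
  rewrite mxx (m1 _ _ abF) /=.
  by refine (hom_ctx [:: a] [::] (hom_dupr _)); rewrite finset.setUC wK.
have [bcF|bcF] := eqVneq [set b; c] F.
  have bF : b \in F by rewrite -bcF !inE eqxx.
  have cF' : c \in F by rewrite -bcF !inE eqxx orbT.
  rewrite (m1 _ _ bcF).
  have [inF|inF] := boolP (a \in F); last first.
    have Fa : K' (F :|: [set a]) by rewrite -bcF finset.setUC finset.setUA.
    rewrite [m a b]mC [m a c]mC !out //=.
    refine (hom_trans (hom_ctx [:: a] [::] (hom_link (esym bcF) (neqF _ _ bcF) cL Lw (K'L inF Fa))) _) => /=.
    have Kab : K [set a; b] by rewrite finset.setUC LK.
    have Kac : K [set a; c] by rewrite finset.setUC LK.
    refine (hom_trans (hom_ctx [::] [:: c] (hom_back Kab)) _) => /=.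
    exact: hom_dup.
  move: inF; rewrite -bcF !inE => /orP[] /eqP aE; last first.
    by move: abF; rewrite aE finset.setUC bcF eqxx.
  rewrite aE mxx (m1 _ _ bcF) /=.
  by refine (hom_ctx [::] [:: c] (hom_dup _)); rewrite wK.
have [acF|acF] := eqVneq [set a; c] F.
  (* With [b] in [F], one of the two sides already excluded would be [F]; otherwise [b] is a vertex
     of the link and may be exchanged for [w]. *)
  have [inF|inF] := boolP (b \in F).
    move: inF; rewrite -acF !inE => /orP[] /eqP bE.
      by move: bcF; rewrite bE acF eqxx.
    by move: abF; rewrite bE acF eqxx.
  have Fb : K' (F :|: [set b]).
    by rewrite -acF -finset.setUA [[set c] :|: _]finset.setUC finset.setUA.
  rewrite (m1 _ _ acF) [m b c]mC !out //=.
  exact: hom_link (esym acF) (neqF _ _ acF) cL (K'L inF Fb) Lw.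
have mNF x y : [set x; y] != F -> m x y = [::] by rewrite /m => /negPf ->.
(* A two-element set [F] contained in the triangle would be one of its sides, and all three are
   excluded by now. *)
rewrite !mNF //=; apply/hom_del3/Kn => //; apply/negP => FS.
have /finset.cards2P[e [f [nef FE]]] : #|F| == 2 by rewrite F2.
have fS : f \in [set a; b; c] by apply: (fintype.subsetP FS); rewrite FE !inE eqxx orbT.
have eS : e \in [set a; b; c] by apply: (fintype.subsetP FS); rewrite FE !inE eqxx.
have neF x y : [set x; y] != F -> [set x; y] != [set e; f] /\ [set y; x] != [set e; f].
  by rewrite -FE => nF; split=> //; rewrite finset.setUC.
have [[ab1 ab2] [bc1 bc2] [ac1 ac2]] := And3 (neF _ _ abF) (neF _ _ bcF) (neF _ _ acF).
move: eS fS; rewrite !inE => /orP[/orP[]|] /eqP ee /orP[/orP[]|] /eqP ff;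
  by move: ab1 ab2 bc1 bc2 ac1 ac2 nef; rewrite ee ff ?eqxx.
Qed.

(** An edge of [K'] is lost only if it equals [F], and two edges through one vertex of the link then
    join its ends. *)
Lemma walk_connected_link :
  (2 <= #|F|)%N -> (#|F| = 2 -> exists z, L [set z]) ->
  walk_connected K' -> walk_connected K.
Proof.
move=> cF c2 cK' x y Kx Ky; have KK' S : K S -> K' S by rewrite KP => /andP[].
apply: connect_sub (cK' x y (KK' _ Kx) (KK' _ Ky)) => {x y Kx Ky} a b K'ab.
have [FS|FS] := boolP (F \subset [set a; b]); last first.
  by apply: connect1; rewrite /adj KP FS andbT.
have F2 : #|F| = 2 by have := subset_leq_card FS; rewrite finset.cards2; lia.
have [w Lw] := c2 F2.
have FE : F = [set a; b] by apply/eqP; rewrite eqEcard FS F2 finset.cards2; case: eqP.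
apply: (@connect_trans _ _ w); apply: connect1; rewrite /adj.
  by apply: link_edge_face; rewrite // FE !inE eqxx.
by rewrite finset.setUC; apply: link_edge_face; rewrite // FE !inE eqxx orbT.
Qed.

End EdgeRemoval.

Lemma walk_connected_full K : (forall x y, K [set x] -> K [set y] -> K [set x; y]) ->
  walk_connected K.
Proof. by move=> Kxy x y Kx Ky; apply/connect1/Kxy. Qed.

(** The vertex after the base point can be deleted again and again. This serves hypergraphs without
    edges, whose independence complex is a full simplex. *)
Lemma walk_simply_connected_full K :
  down_closed K ->
  (forall x y z, K [set x; y] -> K [set y; z] -> K [set x; y; z]) ->
  walk_simply_connected K.
Proof.
move=> dcK Kxyz x p; elim: p => [|y p IH]; first by move=> _; apply: hom_refl.
have [z [q E]] : exists z q, rcons p x = z :: q by case: (p) => [|z q]; eexists; eexists.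
rewrite /= E /= => /and3P[Kxy Kyz pth].
have K3 := Kxyz _ _ _ Kxy Kyz.
refine (hom_trans (hom_ctx [::] q (hom_del3 K3)) _); rewrite /= -E; apply: IH.
rewrite E /= pth andbT; apply: dcK K3.
by apply/fintype.subsetP => t; rewrite !inE => /orP[] ->; rewrite ?orbT.
Qed.

End Walks.

(** * The recursion defining psi *)

Lemma ninf_le_min a x y : ninf_le a (ninf_min x y) = ninf_le a x && ninf_le a y.
Proof.
by case: a x y => [a|] [x|] [y|] //=; rewrite /ninf_min /= ?andbT //;
  case: leqP => /=; lia.
Qed.

Lemma ninf_le_max a x y : ninf_le a (ninf_max x y) = ninf_le a x || ninf_le a y.
Proof.
by case: a x y => [a|] [x|] [y|] //=; rewrite /ninf_max /= ?orbT //;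
  case: leqP => /=; lia.
Qed.

(** The bound is a successor because the initial value [NFin 0] of the maximum would satisfy the
    bound zero without any index. *)
Lemma ninf_le_bigmax (I : finType) (P : pred I) (f : I -> ninf) k :
  ninf_le (NFin k.+1) (\big[ninf_max/NFin 0]_(i | P i) f i) ->
  exists2 i, P i & ninf_le (NFin k.+1) (f i).
Proof.
elim/big_rec: _ => [//|i x Pi IH].
by rewrite ninf_le_max => /orP[fi|/IH //]; exists i.
Qed.

Lemma ninf_le_addn k x d : ninf_le (NFin (k + d)) (ninf_addn x d) = ninf_le (NFin k) x.
Proof. by case: x => //= m; rewrite leq_add2r. Qed.

Lemma ninf_leW j k x : (j <= k)%N -> ninf_le (NFin k) x -> ninf_le (NFin j) x.
Proof. by case: x => //= m; apply: leq_trans. Qed.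

(** * Independence complexes of a hypergraph, of its deletions and of its links *)

Section Hypergraph.
Variable T : finType.
Implicit Types (V F S E : {set T}) (C : {set {set T}}).

Lemma is_faceP V C S :
  reflect (S \subset V /\ forall E, E \in C -> ~~ (E \subset S)) (is_face V C S).
Proof.
apply: (iffP andP) => -[SV H]; split=> //; first by move=> E EC; apply: (forall_inP H).
exact/forall_inP.
Qed.

Lemma down_closed_face V C : down_closed (is_face V C).
Proof.
move=> S S' sS /is_faceP[SV H]; apply/is_faceP; split=> [|E /H].
  exact: fintype.subset_trans SV.
by apply: contra => ES'; apply: fintype.subset_trans sS.
Qed.

Lemma face_set1 V C v : is_hypergraph V C -> is_face V C [set v] = (v \in V).
Proof.
case=> _ [C2 _]; apply/is_faceP/idP; first by case; rewrite finset.sub1set.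
rewrite finset.sub1set; split=> // E /C2 cE.
by apply/negP => /subset_leq_card; rewrite finset.cards1; lia.
Qed.

Lemma is_face_del V C F S :
  F \in C -> is_face V C S = is_face V (C :\ F) S && ~~ (F \subset S).
Proof.
move=> FC; apply/is_faceP/andP => [[SV H]|[/is_faceP[SV H] FS]].
  split; last exact: H.
  by apply/is_faceP; split=> // E /finset.setD1P[_ /H].
split=> // E EC; have [->//|EF] := eqVneq E F.
by apply: H; rewrite !inE EF.
Qed.

Lemma is_hypergraph_del V C F : is_hypergraph V C -> is_hypergraph V (C :\ F).
Proof.
case=> [CV [C2 Ci]]; split; [|split].
- by move=> E /finset.setD1P[_ /CV].
- by move=> E /finset.setD1P[_ /C2].
- by move=> E E' /finset.setD1P[_ EC] /finset.setD1P[_ EC']; apply: Ci.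
Qed.

Section Link.
Variables (V : {set T}) (C : {set {set T}}) (F : {set T}).
Hypotheses (HC : is_hypergraph V C) (FC : F \in C).

Let D := [set E :\: F | E in C :\ F].

Lemma mem_hlinkC G :
  reflect [/\ G \in D, forall H, H \in D -> H \subset G -> H = G & (2 <= #|G|)%N]
    (G \in hlinkC C F).
Proof.
rewrite /hlinkC -/D finset.in_set.
apply: (iffP andP) => [[GD /andP[/forall_inP H cG]]|[GD H cG]]; split=> //.
  by move=> G' G'D G'G; apply/eqP; have /implyP := H _ G'D; apply.
rewrite cG andbT; apply/forall_inP => G' G'D; apply/implyP => sG.
by apply/eqP/H.
Qed.

(** An edge [E] with [E :\: F] empty would be contained in [F], against incomparability. *)
Lemma linkD_neq0 G : G \in D -> (0 < #|G|)%N.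
Proof.
case: HC => [_ [_ Ci]] /finset.imsetP[E /finset.setD1P[EF EC] ->].
rewrite lt0n; apply: contra EF; rewrite finset.cards_eq0 finset.setD_eq0 => sE.
exact/eqP/Ci.
Qed.

(** [hnbhd] ranges over all of [C] and [D] only over [C :\ F], but [F :\: F] is empty and never a
    singleton. *)
Lemma mem_hnbhd z : reflect ([set z] \in D) (z \in hnbhd C F).
Proof.
apply: (iffP finset.bigcupP) => [[E /andP[EC /cards1P[y Ey]] zE]|].
  move: zE; rewrite Ey inE => /eqP->; rewrite -Ey; apply: finset.imset_f.
  rewrite !inE EC andbT; apply/eqP => EF.
  by have := finset.cards1 y; rewrite -Ey EF finset.setDv finset.cards0.
case/finset.imsetP => E /finset.setD1P[_ EC] zE.
by exists E; rewrite ?EC -zE ?finset.cards1 ?inE.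
Qed.

(** An edge of the link through a vertex of the neighbourhood of [F] would contain a singleton of
    [D], hence equal it by minimality, while it has at least two elements. *)
Lemma is_hypergraph_link : is_hypergraph (hlinkV V C F) (hlinkC C F).
Proof.
case: (HC) => [CV _]; split; [|split].
- move=> G /mem_hlinkC[GD Gmin cG]; apply/fintype.subsetP => z zG.
  have [E /finset.setD1P[_ EC] GE] := finset.imsetP GD.
  move: (zG); rewrite GE !inE => /andP[zF zE].
  rewrite (negPf zF) (fintype.subsetP (CV _ EC)) // andbT /=.
  apply/negP => /mem_hnbhd /Gmin; rewrite finset.sub1set => /(_ zG) G1.
  by move: cG; rewrite -G1 finset.cards1.
- by move=> G /mem_hlinkC[].
- by move=> G G' /mem_hlinkC[GD _ _] /mem_hlinkC[_ Gmin _]; apply: Gmin.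
Qed.

Lemma link_face_disjoint S : is_face (hlinkV V C F) (hlinkC C F) S -> [disjoint S & F].
Proof.
case/is_faceP => SV _; apply/pred0P => z /=; apply/negP => /andP[zS zF].
by have := fintype.subsetP SV z zS; rewrite !inE zF.
Qed.

(** For an edge [E] of [C :\ F] inside [F :|: S], take a minimal member [G] of [D] below [E :\: F].
    Either [G] is a singleton, whose vertex was removed from the link, or it is an edge of the link
    inside [S]. *)
Lemma link_face_join S :
  is_face (hlinkV V C F) (hlinkC C F) S -> is_face V (C :\ F) (F :|: S).
Proof.
case: (HC) => [CV _] /is_faceP[SV HS]; apply/is_faceP; split.
  rewrite finset.subUset CV //=; apply: fintype.subset_trans SV _.
  exact: finset.subsetDl.
move=> E EC; apply/negP => EFS.
have ED : E :\: F \in D by apply: finset.imset_f.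
have sES : E :\: F \subset S by rewrite finset.subDset.
pose P G := (G \in D) && (G \subset E :\: F).
have PE : P (E :\: F) by rewrite /P ED fintype.subxx.
have [G /finset.minsetP[/andP[GD sGE] Gmin] _] := finset.minset_exists PE.
have sGS := fintype.subset_trans sGE sES.
have := linkD_neq0 GD; rewrite leq_eqVlt => /orP[|cG].
  rewrite eq_sym => /cards1P[z Gz]; rewrite Gz finset.sub1set in sGS GD.
  by have := fintype.subsetP SV z sGS; rewrite !inE (introT (mem_hnbhd z) GD) orbT.
have /HS : G \in hlinkC C F.
  apply/mem_hlinkC; split=> // H HD sHG; apply: Gmin => //=.
  by rewrite /P HD (fintype.subset_trans sHG).
by rewrite sGS.
Qed.

(** Converse of [link_face_join] for single vertices: if [z] were in the neighbourhood of [F], some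
    edge other than [F] would lie in [F :|: [set z]]. *)
Lemma join_link_vertex z :
  z \notin F -> is_face V (C :\ F) (F :|: [set z]) ->
  is_face (hlinkV V C F) (hlinkC C F) [set z].
Proof.
move=> zF /is_faceP[FzV Hz]; rewrite (face_set1 _ is_hypergraph_link).
rewrite !inE (negPf zF) /= (fintype.subsetP FzV) ?inE ?eqxx ?orbT // andbT.
apply/mem_hnbhd => /finset.imsetP[E EC zE].
by have := Hz E EC; rewrite -finset.subDset -zE fintype.subxx.
Qed.

(** Together with [card_hlinkV] this shows that the fuel suffices for the link. *)
Lemma card_hlinkC : (#|hlinkC C F| < #|C|)%N.
Proof.
rewrite [X in (_ < X)%N](finset.cardsD1 F) FC add1n ltnS.
apply: leq_trans (finset.leq_imset_card (fun E => E :\: F) _).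
by apply/subset_leq_card/fintype.subsetP => G /mem_hlinkC[].
Qed.

Lemma card_hlinkV : (#|hlinkV V C F| <= #|V|)%N.
Proof. exact/subset_leq_card/finset.subsetDl. Qed.

End Link.

(** The three thresholds are proved together, since passing to the link lowers the bound by
    [#|F| - 1]: bound 3 uses bound 2 of the link when [#|F| = 2] and bound 1 when [#|F| = 3], and
    bound 2 uses bound 1 when [#|F| = 2]. *)
Lemma psi_fuel_walk_connected n V C :
  is_hypergraph V C -> (#|V| + #|C| < n)%N ->
  [/\ ninf_le (NFin 1) (psi_fuel n V C) -> exists v, is_face V C [set v],
      ninf_le (NFin 2) (psi_fuel n V C) -> walk_connected (is_face V C) &
      ninf_le (NFin 3) (psi_fuel n V C) -> walk_simply_connected (is_face V C)].
Proof.
elim: n V C => [//|n IH] V C HC cVC /=.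
have [->|[v vV]] := finset.set_0Vmem V; first by rewrite eqxx.
have -> : (V == finset.set0) = false by apply/eqP => V0; rewrite V0 inE in vV.
have v1 : exists v, is_face V C [set v] by exists v; rewrite face_set1.
have [C0|_] := eqVneq C finset.set0.
  have face0 S : is_face V C S = (S \subset V).
    by apply/is_faceP/idP => [[]//|SV]; split=> // E; rewrite C0 inE.
  split=> // _.
    apply: walk_connected_full => x y; rewrite !face0 finset.subUset.
    by move=> -> ->.
  apply: walk_simply_connected_full => [|x y z]; first exact: down_closed_face.
  by rewrite !face0 !finset.subUset => -> /andP[_ ->].
(* The equation on [j] states [j = k.+1 - (#|F| - 1)] without truncated subtraction; it says nothing
   about edges too large for the bound. *)
have step k : ninf_le (NFin k.+1)
    (\big[ninf_max/NFin 0]_(F in C) ninf_min (psi_fuel n V (C :\ F))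
       (ninf_addn (psi_fuel n (hlinkV V C F) (hlinkC C F)) (#|F| - 1))) ->
  exists F, [/\ F \in C, ninf_le (NFin k.+1) (psi_fuel n V (C :\ F)) &
    forall j, (j + #|F| = k.+2)%N ->
       ninf_le (NFin j) (psi_fuel n (hlinkV V C F) (hlinkC C F))].
  case/ninf_le_bigmax => F FC; rewrite ninf_le_min => /andP[h1 h2].
  exists F; split=> // j jE; rewrite -(ninf_le_addn _ _ (#|F| - 1)).
  have := HC.2.1 F FC => cF; apply: ninf_leW h2; lia.
have C2 F : F \in C -> (2 <= #|F|)%N by apply: HC.2.1.
have cdel F : F \in C -> (#|V| + #|C :\ F| < n)%N.
  by move=> FC; move: cVC; rewrite (finset.cardsD1 F C) FC add1n addnS ltnS.
have clink F : F \in C -> (#|hlinkV V C F| + #|hlinkC C F| < n)%N.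
  move=> FC; have := card_hlinkV V C F; have := card_hlinkC FC; lia.
have conn : ninf_le (NFin 2) (\big[ninf_max/NFin 0]_(F in C) ninf_min (psi_fuel n V (C :\ F))
       (ninf_addn (psi_fuel n (hlinkV V C F) (hlinkC C F)) (#|F| - 1))) ->
    walk_connected (is_face V C).
  case/step => F [FC hdel hlink].
  have [_ cdelF _] := IH _ _ (is_hypergraph_del F HC) (cdel F FC).
  have [lk1 _ _] := IH _ _ (is_hypergraph_link F HC) (clink F FC).
  apply: (walk_connected_link (K' := is_face V (C :\ F))
           (L := is_face (hlinkV V C F) (hlinkC C F)) (F := F)).
  - exact: down_closed_face.
  - by move=> S; apply: is_face_del.
  - exact: link_face_disjoint.
  - exact: link_face_join.
  - exact: C2.
  - by move=> F2; apply/lk1/hlink; rewrite F2.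
  - exact: cdelF.
split=> // psi3; case/step: psi3 => F [FC hdel hlink].
have [_ _ cdelF] := IH _ _ (is_hypergraph_del F HC) (cdel F FC).
have [lk1 lk2 _] := IH _ _ (is_hypergraph_link F HC) (clink F FC).
apply: (walk_simply_connected_link (K' := is_face V (C :\ F))
         (L := is_face (hlinkV V C F) (hlinkC C F)) (F := F)).
- exact: down_closed_face.
- exact: down_closed_face.
- by move=> S; apply: is_face_del.
- exact: link_face_disjoint.
- exact: link_face_join.
- exact: join_link_vertex.
- exact: C2.
- by move=> F2; split; [apply: lk1; apply: (@ninf_leW _ 2) => //|apply: lk2]; apply: hlink; rewrite F2.
- by move=> F3; apply/lk1/hlink; rewrite F3.
- exact: cdelF.
Qed.

Lemma psi_walk_connected V C :
  is_hypergraph V C ->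
  [/\ ninf_le (NFin 1) (psi V C) -> exists v, is_face V C [set v],
      ninf_le (NFin 2) (psi V C) -> walk_connected (is_face V C) &
      ninf_le (NFin 3) (psi V C) -> walk_simply_connected (is_face V C)].
Proof. by move=> HC; apply: psi_fuel_walk_connected. Qed.

End Hypergraph.

(** * Homotopies in the realization *)

Import Order.TTheory GRing.Theory Num.Theory.
Import numFieldNormedType.Exports.
Local Open Scope ring_scope.

Section Continuity.
Variables (R : realType) (X : topologicalType).
Implicit Types f g : X -> R.

Lemma cont_add f g : continuous f -> continuous g -> continuous (fun x => f x + g x).
Proof. by move=> cf cg x; exact: (continuousD (cf x) (cg x)). Qed.

Lemma cont_sub f g : continuous f -> continuous g -> continuous (fun x => f x - g x).
Proof. by move=> cf cg x; exact: (continuousB (cf x) (cg x)). Qed.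

Lemma cont_mul f g : continuous f -> continuous g -> continuous (fun x => f x * g x).
Proof. by move=> cf cg x; exact: (continuousM (cf x) (cg x)). Qed.

Lemma cont_cst (a : R) : continuous (fun _ : X => a).
Proof. by move=> x; exact: cvg_cst. Qed.

Lemma cont_min f g : continuous f -> continuous g ->
  continuous (fun x => Num.min (f x) (g x)).
Proof. by move=> cf cg x; exact: (continuous_min (cf x) (cg x)). Qed.

Lemma cont_max f g : continuous f -> continuous g ->
  continuous (fun x => Num.max (f x) (g x)).
Proof. by move=> cf cg x; exact: (continuous_max (cf x) (cg x)). Qed.

Lemma cont_comp (Y : topologicalType) (g : X -> Y) (f : Y -> R) :
  continuous g -> continuous f -> continuous (fun x => f (g x)).
Proof. by move=> cg cf x; exact: (continuous_comp (cg x) (cf _)). Qed.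

Lemma cont_pair (f g : X -> R) : continuous f -> continuous g ->
  continuous (fun x => (f x, g x)).
Proof. by move=> cf cg x; exact: (cvg_pair (cf x) (cg x)). Qed.

End Continuity.

(** The retraction of the line onto the unit interval. *)
Definition clamp {R : realType} (x : R) : R := Num.max 0 (Num.min x 1).

Section Clamp.
Variable R : realType.
Implicit Types x : R.

Lemma clamp_itv x : 0 <= clamp x <= 1.
Proof. by rewrite /clamp; case: (leP x 1) => ?; [case: (leP 0 x)|case: (leP 0 1)] => ?; lra. Qed.

Lemma clamp_id x : 0 <= x <= 1 -> clamp x = x.
Proof. by rewrite /clamp; case: (leP x 1) => ?; [case: (leP 0 x)|case: (leP 0 1)] => ?; lra. Qed.

Lemma clamp_le0 x : x <= 0 -> clamp x = 0.
Proof. by rewrite /clamp; case: (leP x 1) => ?; [case: (leP 0 x)|case: (leP 0 1)] => ?; lra. Qed.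

Lemma clamp_ge1 x : 1 <= x -> clamp x = 1.
Proof. by rewrite /clamp; case: (leP x 1) => ?; [case: (leP 0 x)|case: (leP 0 1)] => ?; lra. Qed.

Lemma clamp_le x : 0 <= x -> clamp x <= x.
Proof. by move=> x0; rewrite /clamp ge_max x0 ge_min lexx. Qed.

Lemma cont_clamp (X : topologicalType) (f : X -> R) :
  continuous f -> continuous (fun p => clamp (f p)).
Proof.
move=> cf; rewrite /clamp; apply: cont_max; first exact: cont_cst.
by apply: cont_min => //; exact: cont_cst.
Qed.

Lemma cont_fst : continuous (fun p : R * R => p.1).
Proof. by move=> x; exact: cvg_fst. Qed.

Lemma cont_snd : continuous (fun p : R * R => p.2).
Proof. by move=> x; exact: cvg_snd. Qed.

Lemma cont_id : continuous (fun x : R => x).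
Proof. by move=> x; exact: cvg_id. Qed.

Lemma unit_intervalE x : unit_interval x = (0 <= x <= 1) :> Prop.
Proof. by rewrite /unit_interval /= in_itv. Qed.

End Clamp.

Ltac cont := repeat first
  [ exact: cont_cst | exact: cont_id | exact: cont_fst | exact: cont_snd
  | apply: cont_sub | apply: cont_add | apply: cont_mul | apply: cont_clamp
  | apply: cont_min | apply: cont_max | apply: cont_pair ].

(** * Barycentric coordinates and the geometric realization *)

Section Realization.
Variables (R : realType) (T : finType).
Implicit Types (S : {set T}) (x y : T -> R).

Definition in_simplex S x :=
  [/\ forall v, 0 <= x v, \sum_v x v = 1 & forall v, v \notin S -> x v = 0].

Definition pt (a : T) : T -> R := fun v => (v == a)%:R.

Definition lerp (s : R) x y : T -> R := fun v => (1 - s) * x v + s * y v.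

Lemma lerp0 x y : lerp 0 x y = x.
Proof. by apply/funext => v; rewrite /lerp; lra. Qed.

Lemma lerp1 x y : lerp 1 x y = y.
Proof. by apply/funext => v; rewrite /lerp; lra. Qed.

Lemma in_simplex_lerp S s x y :
  0 <= s <= 1 -> in_simplex S x -> in_simplex S y -> in_simplex S (lerp s x y).
Proof.
move=> s01 [x0 x1 xS] [y0 y1 yS]; split=> [v||v vS].
- by rewrite /lerp addr_ge0 // mulr_ge0 //; lra.
- by rewrite big_split /= -!mulr_sumr x1 y1; lra.
- by rewrite /lerp xS // yS //; lra.
Qed.

Lemma in_simplex_pt S a : a \in S -> in_simplex S (pt a).
Proof.
move=> aS; split=> [v||v vS]; first exact: ler0n.
  rewrite (bigD1 a) //= /pt eqxx big1 ?addr0 // => i /negPf ->; by [].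
by rewrite /pt; case: eqP vS => // ->; rewrite aS.
Qed.

Definition in_complex (K : pred {set T}) x := exists2 S, K S & in_simplex S x.

(** Asking for some face that contains the support, instead of the support itself being a face,
    makes each closed simplex visibly convex; the two agree because faces are closed under
    subsets. *)
Lemma realizationE V (C : {set {set T}}) :
  realization (R := R) V C = in_complex (is_face V C) :> (_ -> Prop).
Proof.
apply/funext => x; apply/propext; split=> [[x0 [xV [x1 xF]]]|[S FS [x0 x1 xS]]].
  by exists [set v | x v != 0]%SET => //; split=> // v; rewrite inE negbK => /eqP.
have sS : ([set v | x v != 0] \subset S)%SET.
  apply/fintype.subsetP => v; rewrite inE; apply: contraR => vS; exact/eqP/xS.
have [SV _] := is_faceP _ _ _ FS; split=> //; split; last split=> //.
  by move=> v vV; apply: xS; apply: contra vV; apply: (fintype.subsetP SV).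
exact: down_closed_face FS.
Qed.

End Realization.

(** * Free homotopies of loops *)

Section FreeHomotopy.
Variables (R : realType) (T : finType) (X : (T -> R) -> Prop).
Implicit Types f g h : R -> T -> R.

(* Everything is required to be continuous on the whole line or plane, while
   conditions are only imposed over the unit interval: precomposing with [clamp]
   makes this harmless, and continuous maps can then be glued by adding them and
   subtracting their common value. *)
Definition free_homotopic f g := exists G : R * R -> T -> R,
  [/\ forall v, continuous (fun p => G p v),
      forall t s : R, 0 <= t <= 1 -> 0 <= s <= 1 -> X (G (t, s)),
      forall t : R, 0 <= t <= 1 -> G (t, 0) = f t,
      forall t : R, 0 <= t <= 1 -> G (t, 1) = g t &
      forall s : R, 0 <= s <= 1 -> G (0, s) = G (1, s)].

Lemma free_homotopic_sym f g : free_homotopic f g -> free_homotopic g f.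
Proof.
move=> [G [cG XG G0 G1 Gl]]; exists (fun p => G (p.1, 1 - p.2)); split => /=.
- move=> v; apply: (cont_comp (g := fun p : R * R => (p.1, 1 - p.2)) _ (cG v)).
  by apply: cont_pair; cont.
- by move=> t s t01 s01; apply: XG => //; lra.
- by move=> t t01; rewrite subr0 G1.
- by move=> t t01; rewrite subrr G0.
- by move=> s s01; apply: Gl; lra.
Qed.

Lemma free_homotopic_trans f g h :
  free_homotopic f g -> free_homotopic g h -> free_homotopic f h.
Proof.
move=> [G [cG XG G0 G1 Gl]] [H [cH XH H0 H1 Hl]].
(* In the first half [H] rests at its start, in the second [G] rests at its end; both are the middle
   loop [G (c p)], which is subtracted once. *)
pose a (p : R * R) := (p.1, clamp (2 * p.2)).
pose b (p : R * R) := (p.1, clamp (2 * p.2 - 1)).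
pose c (p : R * R) : R * R := (p.1, 1).
exists (fun p v => G (a p) v + H (b p) v - G (c p) v).
have lo (t s : R) : 0 <= t <= 1 -> s <= 1 / 2 ->
    (fun v => G (a (t, s)) v + H (b (t, s)) v - G (c (t, s)) v) = G (t, clamp (2 * s)).
  move=> t01 s2; apply/funext => v; rewrite /a /b /c /= [clamp (2 * s - 1)]clamp_le0; last lra.
  by rewrite H0 // G1 // addrK.
have hi (t s : R) : 0 <= t <= 1 -> 1 / 2 <= s ->
    (fun v => G (a (t, s)) v + H (b (t, s)) v - G (c (t, s)) v) = H (t, clamp (2 * s - 1)).
  move=> t01 s2; apply/funext => v; rewrite /a /b /c /= [clamp (2 * s)]clamp_ge1; last lra.
  by rewrite addrC addKr.
split.
- move=> v; apply: cont_sub; first apply: cont_add.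
  + by apply: (cont_comp (g := a) _ (cG v)); rewrite /a; cont.
  + by apply: (cont_comp (g := b) _ (cH v)); rewrite /b; cont.
  + by apply: (cont_comp (g := c) _ (cG v)); rewrite /c; cont.
- move=> t s t01 s01; case: (leP s (1 / 2)) => s2.
    by rewrite lo //; apply: XG => //; apply: clamp_itv.
  by rewrite hi ?(ltW s2) //; apply: XH => //; apply: clamp_itv.
- by move=> t t01; rewrite lo ?mulr0 ?clamp_le0 ?G0 //; lra.
- by move=> t t01; rewrite hi ?clamp_ge1 ?H1 //; lra.
- move=> s s01; case: (leP s (1 / 2)) => s2.
    by rewrite !lo ?Gl ?clamp_itv //; lra.
  by rewrite !hi ?Hl ?clamp_itv //; lra.
Qed.

(** Interpolates linearly between the two parameters. These may leave the unit interval, so [f]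
    takes values in [X] on the whole line. *)
Lemma free_homotopic_reparam f (phi psi : R -> R) :
  (forall v, continuous (fun t => f t v)) -> (forall t, X (f t)) ->
  continuous phi -> continuous psi ->
  (forall s : R, 0 <= s <= 1 ->
     f ((1 - s) * phi 0 + s * psi 0) = f ((1 - s) * phi 1 + s * psi 1)) ->
  free_homotopic (f \o phi) (f \o psi).
Proof.
move=> cf Xf cphi cpsi loop.
pose a (p : R * R) := (1 - p.2) * phi p.1 + p.2 * psi p.1.
exists (fun p => f (a p)); split.
- move=> v; apply: (cont_comp (g := a) _ (cf v)); rewrite /a.
  apply: cont_add; apply: cont_mul; cont.
    exact: cont_comp (@cont_fst R) cphi.
  exact: cont_comp (@cont_fst R) cpsi.
- by [].
- by move=> t _; rewrite /a /= subr0 mul1r mul0r addr0.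
- by move=> t _; rewrite /a /= subrr mul1r mul0r add0r.
- exact: loop.
Qed.

(* Travel up the side [t = 0] of the free homotopy, across, and down the side
   [t = 1]; once the middle part is constant, retract along the side. *)
Lemma free_null_based f c :
  f 0 = f 1 -> free_homotopic f (fun=> c) ->
  exists H : R * R -> T -> R,
    [/\ forall v, continuous (fun p => H p v),
      forall t s : R, 0 <= t <= 1 -> 0 <= s <= 1 -> X (H (t, s)),
      forall t : R, 0 <= t <= 1 -> H (t, 0) = f t /\ H (t, 1) = f 0 &
      forall s : R, 0 <= s <= 1 -> H (0, s) = f 0 /\ H (1, s) = f 0].
Proof.
move=> f01 [G [cG XG G0 G1 Gl]].
(* On the unit interval, with [0 <= m <= 1], the graph is a trapezoid of height [m] with sides of
   slope 3 and -3; for [m = 1] it is flat exactly on the middle third. *)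
pose roof (m t : R) : R := Num.max 0 (Num.min m (Num.min (3 * t) (3 - 3 * t))).
(* As [p.2] grows from 0 to 1/2, this moves from [p.1] to [clamp (3 * p.1 - 1)], which is constant
   on the outer thirds. Meanwhile the roof in [a] rises to height 1, and [b] lowers it again in the
   second half. *)
pose x (p : R * R) : R := clamp (p.1 + clamp (2 * p.2) * (2 * p.1 - 1)).
pose a (p : R * R) : R * R := (x p, roof (clamp (2 * p.2)) p.1).
pose b (p : R * R) : R * R := (0, roof (1 - clamp (2 * p.2 - 1)) p.1).
pose c' (p : R * R) : R * R := (0, roof 1 p.1).
have roof01 (m t : R) : 0 <= m <= 1 -> 0 <= roof m t <= 1.
  move=> m01; rewrite /roof; case: (leP (3 * t) (3 - 3 * t)) => ?.
    case: (leP m (3 * t)) => ?; [case: (leP 0 m)|case: (leP 0 (3 * t))] => ?; lra.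
  case: (leP m (3 - 3 * t)) => ?; [case: (leP 0 m)|case: (leP 0 (3 - 3 * t))] => ?; lra.
have roofm0 (t : R) : 0 <= t <= 1 -> roof 0 t = 0.
  move=> t01; rewrite /roof; case: (leP (3 * t) (3 - 3 * t)) => ?.
    by case: (leP 0 (3 * t)) => ?; [rewrite maxxx|lra].
  by case: (leP 0 (3 - 3 * t)) => ?; [rewrite maxxx|lra].
have roof0 (m : R) : 0 <= m <= 1 -> roof m 0 = 0.
  move=> m01; rewrite /roof mulr0 subr0; case: (leP 0 (3 : R)) => ?; last lra.
  by case: (leP m 0) => ?; [case: (leP 0 m) => ?; lra | rewrite maxxx].
have roof1 (m : R) : 0 <= m <= 1 -> roof m 1 = 0.
  move=> m01; rewrite /roof mulr1 subrr; case: (leP (3 : R) 0) => ?; first lra.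
  by case: (leP m 0) => ?; [case: (leP 0 m) => ?; lra | rewrite maxxx].
(* The two halves agree when they meet: on the outer thirds because the sides of [G] coincide, on
   the middle third because the roof has height 1, where [G] is constant. *)
have Gside (t : R) : 0 <= t <= 1 -> G (clamp (3 * t - 1), roof 1 t) = G (0, roof 1 t).
  move=> t01; case: (leP t (1 / 3)) => t3; first by rewrite clamp_le0 //; lra.
  case: (leP (2 / 3) t) => t3'.
    by rewrite clamp_ge1 -?Gl //; [apply: roof01; lra | lra].
  have -> : roof 1 t = 1.
    rewrite /roof; case: (leP (3 * t) (3 - 3 * t)) => ?.
      by case: (leP 1 (3 * t)) => ?; [case: (leP 0 (1:R)) => ?; lra | lra].
    by case: (leP 1 (3 - 3 * t)) => ?; [case: (leP 0 (1:R)) => ?; lra | lra].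
  by rewrite !G1 //; [lra | apply: clamp_itv].
have G00 : G (0, 0) = f 0 by rewrite G0 //; lra.
have G10 : G (1, 0) = f 0 by rewrite G0 ?f01 //; lra.
have i01 : forall z : R, 0 <= clamp z <= 1 by exact: clamp_itv.
have i01' (z : R) : 0 <= 1 - clamp z <= 1 by have := clamp_itv z; lra.
exists (fun p v => G (a p) v + G (b p) v - G (c' p) v).
have lo (t s : R) : 0 <= t <= 1 -> s <= 1 / 2 ->
    (fun v => G (a (t, s)) v + G (b (t, s)) v - G (c' (t, s)) v) = G (a (t, s)).
  move=> t01 s2; apply/funext => v; rewrite /b /c' /= [clamp (2 * s - 1)]clamp_le0; last lra.
  by rewrite subr0 addrK.
have hi (t s : R) : 0 <= t <= 1 -> 1 / 2 <= s ->
    (fun v => G (a (t, s)) v + G (b (t, s)) v - G (c' (t, s)) v) = G (b (t, s)).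
  move=> t01 s2; apply/funext => v; rewrite /a /x /c' /= [clamp (2 * s)]clamp_ge1; last lra.
  have -> : t + 1 * (2 * t - 1) = 3 * t - 1 by lra.
  by rewrite Gside // addrC addKr.
have croof (m : R * R -> R) : continuous m -> continuous (fun p => roof (m p) p.1).
  by move=> cm; rewrite /roof; cont.
split.
- move=> v; apply: cont_sub; first apply: cont_add.
  + by apply: (cont_comp (g := a) _ (cG v)); rewrite /a /x; apply: cont_pair; [|apply: croof]; cont.
  + by apply: (cont_comp (g := b) _ (cG v)); rewrite /b; apply: cont_pair; [|apply: croof]; cont.
  + by apply: (cont_comp (g := c') _ (cG v)); rewrite /c'; apply: cont_pair; [|apply: croof]; cont.
- move=> t s t01 s01; case: (leP s (1 / 2)) => s2.
    by rewrite lo //; apply: XG; [apply: i01 | apply: roof01].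
  by rewrite hi ?(ltW s2) //; apply: XG; rewrite ?lexx ?ler01 //; apply: roof01; apply: i01'.
- move=> t t01; split.
    rewrite lo // /a /x /= mulr0 [clamp 0]clamp_le0 // mul0r addr0 clamp_id // roofm0 //.
    exact: G0.
  rewrite hi //; last by lra.
  by rewrite /b /= [clamp _]clamp_ge1 ?subrr ?roofm0 //; lra.
- have z01 : 0 <= (0 : R) <= 1 by rewrite lexx ler01.
  have o01 : 0 <= (1 : R) <= 1 by rewrite lexx ler01.
  move=> s s01; split; case: (leP s (1 / 2)) => s2.
  + by rewrite lo // /a /x /= roof0 // clamp_le0 //; have := i01 (2 * s); lra.
  + by rewrite hi ?(ltW s2) // /b /= roof0.
  + by rewrite lo // /a /x /= roof1 // clamp_ge1 //; have := i01 (2 * s); lra.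
  + by rewrite hi ?(ltW s2) // /b /= roof1.
Qed.

End FreeHomotopy.

(** * Piecewise linear loops *)

Section Polygon.
Variables (R : realType) (T : finType) (K : pred {set T}).
Hypothesis dcK : down_closed K.
Implicit Types (a b c x : T) (u v w : seq T) (s t : R).

Local Notation pt := (pt R).

(* Unit speed: the vertex [nth w i] is visited at time [i]. *)
Fixpoint polygon w s : T -> R :=
  if w is x :: w' then
    if w' is y :: _ then fun z => polygon w' (s - 1) z + (1 - clamp s) * (pt x z - pt y z)
    else pt x
  else fun=> 0.

Arguments polygon : simpl never.

Lemma polygon_cont w z : continuous (fun s => polygon w s z).
Proof.
elim: w => [|x [|y w] IH]; try exact: cont_cst.
rewrite /polygon -/polygon.
apply: cont_add; last by cont.
by apply: (cont_comp (g := fun s => s - 1) _ IH); cont.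
Qed.

Lemma polygon_le0 x w s : s <= 0 -> polygon (x :: w) s = pt x.
Proof.
elim: w x s => [//|y w IH] x s s0; apply/funext => z.
rewrite -[LHS]/(polygon (y :: w) (s - 1) z + (1 - clamp s) * (pt x z - pt y z)).
by rewrite IH ?clamp_le0 //; lra.
Qed.

(** Up to time 1 the tail rests at [y], so the correction term alone moves the point from [x] to
    [y]. *)
Lemma polygon_le1 x y w s : s <= 1 ->
  polygon [:: x, y & w] s = lerp (clamp s) (pt x) (pt y).
Proof.
move=> s1; apply/funext => z.
rewrite -[LHS]/(polygon (y :: w) (s - 1) z + (1 - clamp s) * (pt x z - pt y z)).
by rewrite polygon_le0 /lerp; lra.
Qed.

Lemma polygon_ge1 x y w s : 1 <= s ->
  polygon [:: x, y & w] s = polygon (y :: w) (s - 1).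
Proof.
move=> s1; apply/funext => z.
rewrite -[LHS]/(polygon (y :: w) (s - 1) z + (1 - clamp s) * (pt x z - pt y z)).
by rewrite clamp_ge1 // subrr mul0r addr0.
Qed.

Lemma polygon_last x w s : (size w)%:R <= s -> polygon (x :: w) s = pt (last x w).
Proof.
elim: w x s => [//|y w IH] x s /=; rewrite -natr1 => ws.
have := ler0n R (size w) => w0.
by rewrite polygon_ge1 ?IH //; lra.
Qed.

Lemma in_simplex_edge (S : {set T}) x y s :
  x \in S -> y \in S -> in_simplex S (lerp (clamp s) (pt x) (pt y)).
Proof.
move=> xS yS; apply: in_simplex_lerp; [exact: clamp_itv | exact: in_simplex_pt..].
Qed.

Lemma polygon_complex x w s : K [set x]%SET -> path (adj K) x w ->
  in_complex K (polygon (x :: w) s).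
Proof.
elim: w x s => [|y w IH] x s Kx /=.
  by move=> _; exists [set x]%SET => //; apply: in_simplex_pt; rewrite inE.
case/andP=> Kxy pth; case: (leP s 1) => s1.
  rewrite polygon_le1 //.
  by exists [set x; y]%SET => //; apply: in_simplex_edge; rewrite !inE eqxx ?orbT.
rewrite polygon_ge1 ?ltW //.
by apply: IH => //; apply: dcK Kxy; apply: finset.subsetUr.
Qed.

(** Only the ends of the edge being traversed have nonzero coordinates, and each is visited within
    one unit of time. *)
Lemma polygon_near x w s z : 0 <= s <= (size w)%:R -> polygon (x :: w) s z != 0 ->
  exists i, [/\ (i <= size w)%N, `|s - i%:R| <= 1 & nth x (x :: w) i = z].
Proof.
elim: w x s => [|y w IH] x s /=.
  move=> s0; rewrite -[polygon _ _ _]/(pt x z) /pt; have [->|] := eqVneq z x; last by rewrite eqxx.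
  by exists 0%N; split=> //; rewrite subr0 ger0_norm; lra.
move=> sw.
case: (leP s 1) => s1.
  rewrite polygon_le1 // /lerp /pt.
  have [->|zx] := eqVneq z x.
    by exists 0%N; split=> //; rewrite subr0 ger0_norm; lra.
  have [->|zy] := eqVneq z y; last by rewrite !mulr0 addr0 eqxx.
  by exists 1%N; split=> //; rewrite ler_norml; lra.
rewrite polygon_ge1 ?ltW // => /IH[|i [iw si iz]].
  by move: sw; rewrite -natr1; lra.
exists i.+1; split=> //; last by rewrite -iz; apply: set_nth_default.
by move: si; rewrite -natr1 !ler_norml; lra.
Qed.

(* The shortened loop is run with a pause of unit length at the vertex [a]. *)
Lemma polygon_del u v a b c s :
  K [set a; b; c]%SET -> sorted (adj K) (u ++ [:: a, b, c & v]) ->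
  exists2 S, K S & in_simplex S (polygon (u ++ [:: a, b, c & v]) s) /\
    in_simplex S (polygon (u ++ [:: a, c & v]) (s - clamp (s - (size u)%:R))).
Proof.
(* Counted from the visit to [a], both walks stay in the triangle up to time 2; afterwards the
   delayed short walk coincides with the long one. *)
move=> Kabc; have Sabc t : t <= 2 ->
    in_simplex [set a; b; c]%SET (polygon [:: a, b, c & v] t) /\
    in_simplex [set a; b; c]%SET (polygon [:: a, c & v] (t - clamp t)).
  move=> t2; split; last first.
    rewrite polygon_le1; first by apply: in_simplex_edge; rewrite !inE eqxx ?orbT.
    by case: (leP t 1) => t1; [have := clamp_itv t; lra | rewrite clamp_ge1; lra].
  case: (leP t 1) => t1.
    by rewrite polygon_le1 //; apply: in_simplex_edge; rewrite !inE eqxx ?orbT.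
  rewrite polygon_ge1 ?ltW // polygon_le1; last lra.
  by apply: in_simplex_edge; rewrite !inE eqxx ?orbT.
elim: u s => [|x u IH] s.
  rewrite /= subr0 => /and3P[Kab Kbc pth].
  case: (leP s 2) => s2.
    by exists [set a; b; c]%SET => //; apply: Sabc.
  have Kc : K [set c]%SET by apply: dcK Kbc; apply: finset.subsetUr.
  have [S KS inS] := polygon_complex (s - 1 - 1) Kc pth.
  exists S => //.
  rewrite clamp_ge1; last lra.
  by rewrite !polygon_ge1 //; lra.
move=> pth.
have [y [r [r' [Er Er']]]] : exists y r r', u ++ [:: a, b, c & v] = y :: r /\
    u ++ [:: a, c & v] = y :: r'.
  by case: (u) => [|y u']; do 3 eexists.
move: pth IH; rewrite !cat_cons Er Er' => /andP[Kxy pth] IH.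
have su : (size (x :: u))%:R = (size u)%:R + 1 :> R by rewrite /= natr1.
have u0 := ler0n R (size u).
case: (leP s 1) => s1.
  exists [set x; y]%SET => //.
  rewrite su [clamp (s - _)]clamp_le0; last lra.
  by rewrite subr0 !polygon_le1 //; split; apply: in_simplex_edge; rewrite !inE eqxx ?orbT.
have [S KS [in1 in2]] := IH (s - 1) pth.
exists S => //; rewrite polygon_ge1 ?ltW //; split=> //.
have := in2; have -> : s - 1 - (size u)%:R = s - ((size u)%:R + 1) by lra.
rewrite su; have := clamp_itv (s - ((size u)%:R + 1)) => c01.
(* The pause begins no earlier than time 1, so the delayed time cannot fall below 1 when [s] exceeds
   1. *)
case: (leP 1 (s - clamp (s - ((size u)%:R + 1)))) => s'.
  by rewrite polygon_ge1 // addrAC.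
have [s2|s2] := leP s ((size u)%:R + 1); first by move: s'; rewrite clamp_le0; lra.
by have := @clamp_le _ (s - ((size u)%:R + 1)); lra.
Qed.

End Polygon.

(** * From homotopies of closed walks to free homotopies of loops *)

Section Loops.
Variables (R : realType) (T : finType) (K : pred {set T}).
Hypothesis dcK : down_closed K.
Implicit Types (a b c x : T) (u v w : seq T) (s t : R) (f g : R -> T -> R).

(** At each time the two points share a closed simplex, which contains the segment between them. *)
Lemma free_homotopic_line f g :
  (forall z, continuous (fun t => f t z)) -> (forall z, continuous (fun t => g t z)) ->
  (forall t, 0 <= t <= 1 -> exists2 S, K S & in_simplex S (f t) /\ in_simplex S (g t)) ->
  f 0 = f 1 -> g 0 = g 1 -> free_homotopic (in_complex K) f g.
Proof.
move=> cf cg fgS f01 g01; exists (fun p => lerp p.2 (f p.1) (g p.1)); split=> /=.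
- move=> z; apply: cont_add; apply: cont_mul; cont.
    exact: cont_comp (@cont_fst R) (cf z).
  exact: cont_comp (@cont_fst R) (cg z).
- by move=> t s /fgS[S KS [fS gS]] s01; exists S => //; apply: in_simplex_lerp.
- by move=> t _; rewrite lerp0.
- by move=> t _; rewrite lerp1.
- by move=> s _; rewrite f01 g01.
Qed.

(** The number of edges is [(size w).-1], so the whole walk is run over the unit interval. *)
Definition loop w t : T -> R := polygon w (t * (size w).-1%:R).

(** Boolean, so that its invariance under moves is an equation and passes through symmetry and
    transitivity. *)
Definition closed_walk x w :=
  [&& K [set x]%SET, w != [::], head x w == x, last x w == x & sorted (adj K) w].

Lemma closed_walkP x w : closed_walk x w ->
  exists r, [/\ w = x :: r, K [set x]%SET, last x r = x & path (adj K) x r].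
Proof. by case: w => [|y r] /and5P[] // Kx _ /= /eqP-> /eqP rl pth; exists r. Qed.

Lemma closed_walk_del x u v a b c : K [set a; b; c]%SET ->
  closed_walk x (u ++ [:: a, b, c & v]) = closed_walk x (u ++ [:: a, c & v]).
Proof.
move=> Kabc; have sub y z : [set y; z]%SET \subset [set a; b; c]%SET -> adj K y z.
  by move=> yz; apply: dcK Kabc.
have [Kab Kbc Kac] : [/\ adj K a b, adj K b c & adj K a c].
  by split; apply: sub; apply/fintype.subsetP => z; rewrite !inE => /orP[] ->; rewrite ?orbT.
rewrite /closed_walk !last_cat /=; case: u => [|y u] /=.
  by rewrite Kab Kbc Kac.
by rewrite !cat_path /= Kab Kbc Kac.
Qed.

(** Before time 0 and after the last visit the polygon rests at [x]. Interpolated parameters still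
    start and end in these ranges, so every intermediate curve is closed. *)
Lemma free_homotopic_polygon x w (phi psi : R -> R) :
  closed_walk x w -> continuous phi -> continuous psi ->
  phi 0 <= 0 -> psi 0 <= 0 -> (size w).-1%:R <= phi 1 -> (size w).-1%:R <= psi 1 ->
  free_homotopic (in_complex K) (polygon w \o phi) (polygon w \o psi).
Proof.
move=> /closed_walkP[r [-> Kx rx pth]] cphi cpsi phi0 psi0 phi1 psi1.
apply: free_homotopic_reparam => //; first exact: polygon_cont.
  by move=> t; apply: polygon_complex.
move=> s s01; rewrite polygon_le0; last first.
  have := mulr_ge0_le0 (_ : 0 <= 1 - s) phi0; have := mulr_ge0_le0 (_ : 0 <= s) psi0.
  lra.
rewrite polygon_last ?rx //=.
have := ler_wpM2l (_ : 0 <= 1 - s) phi1; have := ler_wpM2l (_ : 0 <= s) psi1.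
rewrite /=; nra.
Qed.

Lemma cont_scale (r : R) : continuous (fun t => t * r).
Proof. by cont. Qed.

(** The equation is part of the induction because the intermediate walk of [hom_trans] must be known
    to be closed. *)
Lemma free_homotopic_hom x w w' : walk_homotopic K w w' ->
  closed_walk x w = closed_walk x w' /\
  (closed_walk x w -> free_homotopic (in_complex K) (loop w) (loop w')).
Proof.
elim=> {w w'} [u v a b c Kabc|w|w1 w2 _ [E12 H]|w1 w2 w3 _ [E12 H12] _ [E23 H23]].
- have E := closed_walk_del x u v Kabc; split=> // cw; have cw' := cw; rewrite E in cw'.
  set w := u ++ _ in cw *; set w' := u ++ _ in cw' *.
  pose phi s : R := s - clamp (s - (size u)%:R).
  have sw : (size w).-1%:R = (size w').-1%:R + 1 :> R.
    by rewrite /w /w' !size_cat /= !addnS /= natr1.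
  have uw : (size u)%:R + 1 <= (size w').-1%:R :> R.
    by rewrite natr1 ler_nat /w' size_cat /= !addnS ltnS leq_addr.
  have u0 := ler0n R (size u).
  have phiM : phi (1 * (size w).-1%:R) = (size w').-1%:R.
    by rewrite /phi mul1r sw clamp_ge1; lra.
  have phi0 : phi (0 * (size w).-1%:R) = 0.
    by rewrite /phi mul0r clamp_le0; lra.
  have cphi : continuous (fun t => phi (t * (size w).-1%:R)).
    by rewrite /phi; cont.
  (* The long loop is pushed along segments to the short loop with a pause, and a change of
     parameter then removes the pause. *)
  apply: free_homotopic_trans
    (_ : free_homotopic _ (polygon w' \o (fun t => phi (t * (size w).-1%:R))) _).
    have [r [Ew Kx rx pth]] := closed_walkP cw.
    have [r' [Ew' _ rx' pth']] := closed_walkP cw'.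
    apply: free_homotopic_line => [z|z|t t01| |].
    + exact: cont_comp (@cont_scale (size w).-1%:R) (@polygon_cont R T w z).
    + exact: cont_comp cphi (@polygon_cont R T w' z).
    + by case/and5P: cw => _ _ _ _ sw1; apply: polygon_del.
    + rewrite /loop mul0r mul1r Ew polygon_le0 // polygon_last ?rx //.
    + by rewrite /= phi0 phiM Ew' polygon_le0 // polygon_last ?rx'.
  apply: (free_homotopic_polygon cw') => //; first exact: cont_scale.
  + by rewrite phi0.
  + by rewrite phiM.
  + by rewrite /= mul1r.
- split=> // cw; apply: (free_homotopic_polygon cw); rewrite /= ?mul0r ?mul1r //;
    exact: cont_scale.
- by split=> // cw; apply/free_homotopic_sym/H; rewrite E12.
- split=> [|cw]; first by rewrite E12.
  by apply: free_homotopic_trans (H12 cw) (H23 _); rewrite -E12.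
Qed.

Lemma loop_null x p : walk_simply_connected K -> K [set x]%SET ->
  path (adj K) x (rcons p x) ->
  free_homotopic (in_complex K) (loop (x :: rcons p x)) (fun=> pt R x).
Proof.
move=> sc Kx pth.
have -> : (fun=> pt R x) = loop [:: x; x].
  apply/funext => t; rewrite /loop mulr1; case: (leP t 1) => t1.
    by rewrite polygon_le1 //; apply/funext => z; rewrite /lerp; lra.
  by rewrite polygon_last // ltW.
apply: (free_homotopic_hom x (sc _ _ pth)).2.
by rewrite /closed_walk /= Kx last_rcons !eqxx.
Qed.

End Loops.

(** * Simplicial approximation of loops *)

Section Approximation.
Variables (R : realType) (T : finType).

(** Stated for all large [n], so that finitely many coordinates can share one [n]. Only [t] is
    confined to the compact segment. *)
Lemma uniform_continuity (f : R -> R) (e : R) : continuous f -> 0 < e ->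
  \forall n \near \oo%classic, forall t s : R, 0 <= t <= 1 ->
    `|t - s| <= n.+1%:R^-1 -> `|f t - f s| < e.
Proof.
move=> cf e0.
pose P (n : nat) (t : R) := forall s : R, `|t - s| <= n.+1%:R^-1 -> `|f t - f s| < e.
have : \forall n \near \oo%classic, (`[0%R, 1%R] `<=` P n)%classic.
  apply: (compact_near_coveringP _).1; first exact: segment_compact.
  move=> t _; have e2 : 0 < e / 2 by lra.
  have /cvgrPdist_lt /(_ _ e2) /nbhs_ballP[r /= r0 Br] := cf t.
  have r2 : 0 < r / 2 by lra.
  (* Both radii are halved so that [t'] and every [s] close to it stay within [r] of [t]. *)
  exists (ball t (r / 2), [set n | n.+1%:R^-1 < r / 2]%classic).
    split; first exact: nbhsx_ballx.
    exact: (near_infty_natSinv_lt (PosNum r2)).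
  case=> t' n /= [Bt' nr] s t's.
  have Bt : ball t r t' by apply: le_ball Bt'; lra.
  have Bs : ball t r s.
    move: Bt' nr t's; rewrite -!ball_normE /= => Bt' nr t's.
    have := ler_normD (t - t') (t' - s); rewrite addrA subrK => /le_lt_trans; apply.
    by rewrite [r]splitr ltrD // (le_lt_trans t's).
  have := Br _ Bt; have := Br _ Bs; rewrite /= => fs ft.
  have := ler_normD (f t' - f t) (f t - f s); rewrite addrA subrK [`|f t' - f t|]distrC.
  by move/le_lt_trans; apply; rewrite [e]splitr ltrD.
apply: filterS => n nP t s t01; apply: nP.
by rewrite /= in_itv.
Qed.

(** Some coordinate is at least the average. *)
Lemma exists_large (y : T -> R) : \sum_v y v = 1 -> exists v, #|T|%:R^-1 <= y v.
Proof.
move=> y1; case: (pickP (fun v => #|T|%:R^-1 <= y v)) => [v yv|ny]; first by exists v.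
have T0 : (0 < #|T|)%N.
  rewrite lt0n; apply/negP => /eqP T0; move: y1; rewrite big_pred0.
    by move/eqP; rewrite eq_sym oner_eq0.
  by move=> v; have := card0_eq T0 v; rewrite !inE.
have [v0 _] : exists v : T, v \in T by apply/card_gt0P.
have : \sum_v y v < \sum_(v : T) #|T|%:R^-1.
  apply: ltr_sum; first by apply/hasP; exists v0; rewrite ?mem_index_enum.
  by move=> v _; rewrite ltNge ny.
by rewrite y1 sumr_const -[_ *+ _]mulr_natl divff ?ltxx // pnatr_eq0 -lt0n.
Qed.

Variable K : pred {set T}.
Hypothesis dcK : down_closed K.

Lemma in_complex_supp (y : T -> R) : in_complex K y -> K [set v | y v != 0]%SET.
Proof.
case=> S KS [_ _ yS]; apply: dcK KS.
by apply/fintype.subsetP => v; rewrite inE; apply: contraR => /yS ->.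
Qed.

(** Sample the loop finely and pick at each sample a vertex with coordinate at least [#|T|%:R^-1].
    By uniform continuity this coordinate stays nonzero up to the neighbouring samples, so at each
    time the polygon lies in the simplex spanned by the support of [f t]. *)
Lemma simplicial_approximation (f : R -> T -> R) :
  (forall z, continuous (fun t => f t z)) -> (forall t, in_complex K (f t)) ->
  f 0 = f 1 ->
  exists x p, [/\ K [set x]%SET, path (adj K) x (rcons p x) &
    free_homotopic (in_complex K) f (loop (x :: rcons p x))].
Proof.
move=> cf Kf f01.
have large t : exists v, #|T|%:R^-1 <= f t v.
  by have [S _ [_ f1 _]] := Kf t; apply: exists_large.
have [x0 _] := large 0.
(* A function of the point and not of the time, so that [f 0 = f 1] closes the walk; the default
   [x0] is never taken at points of [f]. *)
pose c (y : T -> R) := odflt x0 [pick v | #|T|%:R^-1 <= y v].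
have cP t : #|T|%:R^-1 <= f t (c (f t)).
  by rewrite /c; case: pickP => //= nf; have [v] := large t; have := nf v => /= ->.
have T0 : 0 < #|T|%:R^-1 :> R.
  by rewrite invr_gt0 ltr0n; apply/card_gt0P; exists x0.
have [n nP] : exists n : nat, forall (z : T) (t s : R), 0 <= t <= 1 ->
    `|t - s| <= n.+1%:R^-1 -> `|f t z - f s z| < #|T|%:R^-1.
  have : \forall n \near \oo%classic, forall (z : T) (t s : R), 0 <= t <= 1 ->
    `|t - s| <= n.+1%:R^-1 -> `|f t z - f s z| < #|T|%:R^-1.
    by apply: filter_forall => z; apply: uniform_continuity.
  by move=> /filter_ex [n nP]; exists n.
pose N : R := n.+1%:R.
have N0 : 0 < N by rewrite ltr0n.
pose W i := c (f (i%:R / N)).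
have W0 : W n.+1 = W 0%N by rewrite /W divff ?gt_eqF // mul0r f01.
pose p := [seq W i | i <- iota 1 n].
have iE : iota 1 n.+1 = rcons (iota 1 n) n.+1.
  by rewrite -(addn1 n) iotaD cats1 add1n addn1.
have wE : W 0%N :: rcons p (W 0%N) = [seq W i | i <- iota 0 n.+2].
  by rewrite -[iota 0 n.+2]/(0%N :: iota 1 n.+1) iE map_cons map_rcons W0.
have size_p : size (rcons p (W 0%N)) = n.+1 by rewrite size_rcons size_map size_iota.
have wnth x i : (i <= n.+1)%N -> nth x (W 0%N :: rcons p (W 0%N)) i = W i.
  by move=> iN; rewrite wE (nth_map 0%N) ?size_iota // nth_iota.
have i01 i : (i <= n.+1)%N -> 0 <= i%:R / N <= 1 :> bool.
  move=> iN; apply/andP; split; first by apply: divr_ge0; [exact: ler0n | exact: ltW].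
  by rewrite ler_pdivrMr // mul1r ler_nat.
(* a vertex visited at a time close to [t] lies in the support of [f t] *)
have suppW t i : 0 <= t <= 1 -> (i <= n.+1)%N -> `|t * N - i%:R| <= 1 ->
    f t (W i) != 0.
  move=> t01 iN ti.
  have : `|i%:R / N - t| <= n.+1%:R^-1.
    have -> : i%:R / N - t = (i%:R - t * N) / N by rewrite mulrBl mulfK // gt_eqF.
    by rewrite normrM distrC [`|N^-1|]gtr0_norm ?invr_gt0 // ler_piMl // invr_ge0 ltW.
  move=> /(nP (W i) _ _ (i01 _ iN)); have := cP (i%:R / N); rewrite -/(W i) ltr_norml => h1 h2.
  by apply/eqP => ft; move: h2; rewrite ft; lra.
have suppK t : K [set v | f t v != 0]%SET by apply: in_complex_supp.
have Kx : K [set W 0%N]%SET.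
  apply: dcK (suppK 0); rewrite finset.sub1set inE; apply: suppW => //.
    by rewrite lexx ler01.
  by rewrite mul0r subrr normr0 ler01.
have pth : path (adj K) (W 0%N) (rcons p (W 0%N)).
  apply/(pathP (W 0%N)) => i; rewrite size_p => iN.
  have -> : nth (W 0%N) (rcons p (W 0%N)) i = W i.+1 by apply: (wnth (W 0%N) i.+1 iN).
  (* Consecutive vertices both lie in the support of [f] at the earlier of the two sample times. *)
  rewrite wnth ?(ltnW iN) //; apply: dcK (suppK (i%:R / N)).
  have i01' := i01 i (ltnW iN).
  have iN' : i%:R / N * N = i%:R by rewrite mulfVK // gt_eqF.
  rewrite finset.subUset !finset.sub1set !inE.
  apply/andP; split; apply: suppW; rewrite // ?(ltnW iN) // iN'.
    by rewrite subrr normr0 ler01.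
  by rewrite -natr1 opprD addrA subrr sub0r normrN normr1.
exists (W 0%N), p; split=> //.
have loopN : loop (W 0%N :: rcons p (W 0%N)) =
    (fun t => polygon (W 0%N :: rcons p (W 0%N)) (t * N)).
  by apply/funext => t; rewrite /loop /= size_p.
apply: free_homotopic_line => // [z|t t01|].
- rewrite loopN; exact: cont_comp (@cont_scale R N) (@polygon_cont R T _ z).
- exists [set v | f t v != 0]%SET => //; split.
    by have [S _ [f0 f1 _]] := Kf t; split=> // v; rewrite inE negbK => /eqP.
  rewrite loopN.
  have [S _ [q0 q1 _]] := polygon_complex dcK (t * N) Kx pth.
  split=> // v; rewrite inE negbK; apply: contraTeq => /polygon_near [|i].
    by rewrite size_p -/N; have t0 : 0 <= t * N <= 1 * N; [nra | rewrite mul1r in t0].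
  by rewrite size_p => -[iN ti <-]; rewrite wnth // suppW.
- by rewrite loopN mul0r mul1r polygon_le0 // polygon_last ?last_rcons ?size_p.
Qed.

End Approximation.

(** * Path connectedness and simple connectedness *)

Section Connectedness.
Variables (R : realType) (T : finType) (K : pred {set T}).
Hypothesis dcK : down_closed K.

(** Turns continuity relative to the unit interval into continuity on the line, as the gluing of
    homotopies requires. *)
Lemma continuous_clamp (f : R -> R) :
  {within unit_interval (R := R), continuous f}%classic -> continuous (fun t => f (clamp t)).
Proof.
move=> /subspace_continuousP cf t.
have ct : unit_interval (clamp t : R) by rewrite unit_intervalE clamp_itv.
apply: (cvg_comp _ _ _ (cf _ ct)) => A /= Anear.
have cc : continuous (@clamp R) by apply: cont_clamp; cont.
apply: (@filterS _ (nbhs t) _ (fun s => unit_interval (clamp s) -> A (clamp s))).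
  by move=> s; apply; rewrite unit_intervalE; apply: clamp_itv.
exact: cc t _ Anear.
Qed.

Definition reachable (a b : T -> R) := exists g : R -> T -> R,
  [/\ forall z, continuous (fun t => g t z),
      forall t : R, 0 <= t <= 1 -> in_complex K (g t), g 0 = a & g 1 = b].

Lemma reachable_line S a b :
  K S -> in_simplex S a -> in_simplex S b -> reachable a b.
Proof.
move=> KS aS bS; exists (fun t => lerp t a b); split; rewrite ?lerp0 ?lerp1 //.
  by move=> z; rewrite /lerp; cont.
by move=> t t01; exists S => //; apply: in_simplex_lerp.
Qed.

Lemma reachable_trans a b c : reachable a b -> reachable b c -> reachable a c.
Proof.
move=> [g [cg Kg g0 g1]] [h [ch Kh h0 h1]].
exists (fun t z => g (clamp (2 * t)) z + h (clamp (2 * t - 1)) z - b z).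
have lo t : t <= 1 / 2 ->
    (fun z => g (clamp (2 * t)) z + h (clamp (2 * t - 1)) z - b z) = g (clamp (2 * t)).
  by move=> t2; apply/funext => z; rewrite [clamp (2 * t - 1)]clamp_le0 ?h0 ?addrK //; lra.
have hi t : 1 / 2 <= t ->
    (fun z => g (clamp (2 * t)) z + h (clamp (2 * t - 1)) z - b z) = h (clamp (2 * t - 1)).
  move=> t2; apply/funext => z; rewrite [clamp (2 * t)]clamp_ge1 ?g1; last lra.
  by rewrite addrC addKr.
split.
- move=> z; apply: cont_sub; last by cont.
  apply: cont_add.
    by apply: (cont_comp (g := fun t : R => clamp (2 * t)) _ (cg z)); cont.
  by apply: (cont_comp (g := fun t : R => clamp (2 * t - 1)) _ (ch z)); cont.
- move=> t t01; case: (leP t (1 / 2)) => t2.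
    by rewrite lo //; apply/Kg/clamp_itv.
  by rewrite hi ?(ltW t2) //; apply/Kh/clamp_itv.
- by rewrite lo ?mulr0 ?clamp_le0 //.
- by rewrite hi ?clamp_ge1 //; lra.
Qed.

(** Any vertex of a simplex containing [a] will do, joined to [a] by a segment run in either
    direction. *)
Lemma reachable_vertex a : in_complex K a ->
  exists2 x, K [set x]%SET & reachable a (pt R x) /\ reachable (pt R x) a.
Proof.
case=> S KS aS; have [a0 a1 _] := aS.
have [x xS] : exists x, x \in S.
  have [v av] := exists_large a1; exists v; apply: contraTT av => vS.
  have [_ _ ->//] := aS; rewrite -ltNge invr_gt0 ltr0n; apply/card_gt0P.
  by exists v.
exists x; first by apply: dcK KS; rewrite finset.sub1set.
by split; apply: reachable_line KS _ _ => //; apply: in_simplex_pt.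
Qed.

Lemma reachable_connect x y : connect (adj K) x y -> K [set x]%SET ->
  reachable (pt R x) (pt R y).
Proof.
case/connectP => p + -> {y}; elim: p x => [|y p IH] x /=.
  by move=> _ Kx; apply: (reachable_line Kx); apply: in_simplex_pt; rewrite inE.
case/andP=> Kxy pth Kx; apply: (@reachable_trans _ (pt R y)).
  by apply: (reachable_line Kxy); apply: in_simplex_pt; rewrite !inE eqxx ?orbT.
by apply: IH => //; apply: dcK Kxy; apply: finset.subsetUr.
Qed.

Lemma path_connected_complex x : K [set x]%SET -> walk_connected K ->
  path_connected (in_complex K : set (T -> R)).
Proof.
move=> Kx cK; split.
  by exists (pt R x), [set x]%SET => //; apply: in_simplex_pt; rewrite inE.
move=> a b /reachable_vertex[y Ky [ay _]] /reachable_vertex[z Kz [_ zb]].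
have [g [cg Kg g0 g1]] := reachable_trans (reachable_trans ay (reachable_connect (cK _ _ Ky Kz) Ky)) zb.
exists g; split; first by move=> v; apply: continuous_subspaceT.
by split=> // t; rewrite unit_intervalE; apply: Kg.
Qed.

Lemma simply_connected_complex : path_connected (in_complex K : set (T -> R)) ->
  walk_simply_connected K -> simply_connected (in_complex K : set (T -> R)).
Proof.
move=> pcK scK; split=> // g [cg [Kg [_ g10]]].
(* Extends the loop to the line by constants without changing it on the unit interval. *)
pose f t := g (clamp t).
have cf z : continuous (fun t => f t z) := continuous_clamp (cg z).
have Kf t : in_complex K (f t) by apply: Kg; rewrite unit_intervalE clamp_itv.
have f0 : f 0 = g 0 by rewrite /f clamp_le0.
have f1 : f 0 = f 1 by rewrite f0 /f clamp_ge1 // g10.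
have [x [p [Kx pth fp]]] := simplicial_approximation dcK cf Kf f1.
have [H [cH KH H0 Hs]] := free_null_based f1 (free_homotopic_trans fp (loop_null R dcK scK Kx pth)).
exists H; split; first by move=> z; apply: continuous_subspaceT.
split; first by move=> [t s] []; rewrite !unit_intervalE; apply: KH.
split=> t; rewrite unit_intervalE => t01.
  by have [-> ->] := H0 t t01; rewrite f0 /f clamp_id.
by rewrite -f0; apply: Hs.
Qed.

End Connectedness.

Theorem theorem3p4 (R : realType) (T : finType) (V : {set T}) (C : {set {set T}}) :
  is_hypergraph V C ->
  (ninf_le (NFin 2) (psi V C) -> path_connected (realization (R := R) V C)) /\
  (ninf_le (NFin 3) (psi V C) -> simply_connected (realization (R := R) V C)).
Proof.
move=> HC; have [h1 h2 h3] := psi_walk_connected HC; have dcK := @down_closed_face T V C.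
have pc : ninf_le (NFin 2) (psi V C) -> path_connected (realization (R := R) V C).
  move=> psi2; have [v Kv] := h1 (ninf_leW (isT : 1 <= 2)%N psi2).
  by rewrite realizationE; apply: (path_connected_complex R dcK Kv); apply: h2.
split=> // psi3; have := pc (ninf_leW (isT : 2 <= 3)%N psi3).
by rewrite realizationE => pc2; apply: simply_connected_complex pc2 (h3 psi3).
Qed.
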